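(* Let $G$ be a finite abelian group of order $n$ and exponent $m$, and let $D(G)$ be its Davenport constant. Then for every positive integer $k\le 7$ such that $\frac{n}{m}\ge k$, $$D(G)\le \frac{n}{k}+(k-1).$$
   Context: For a finite abelian group $G$ (written additively), a sequence of elements of $G$ (not necessarily distinct) is a zero-sum sequence if the sum of its terms is $0$. The Davenport constant $D(G)$ is the smallest positive integer $d$ such that every sequence of $d$ elements of $G$ contains a nonempty zero-sum subsequence. *)

(* Defs.v *)
From HB Require Import structures.
From mathcomp Require Import all_boot all_order all_algebra all_fingroup all_solvable.

Set Implicit Arguments.
Unset Strict Implicit.
Unset Printing Implicit Defensive.

Import GRing.Theory.
Local Open Scope ring_scope.

Section Davenport.

Variable G : finZmodType.

(* Subsequences are given by their sets of positions, so repeated terms of s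
   are handled with multiplicity. *)
Definition has_zero_sum_subseq (d : nat) (s : d.-tuple G) : bool :=
  [exists A : {set 'I_d}, (A != set0) && (\sum_(i in A) tnth s i == 0)].

Definition davenport_pred (d : nat) : bool :=
  (0 < d)%N && [forall s : d.-tuple G, has_zero_sum_subseq s].

Lemma davenport_exists : exists d, davenport_pred d.
Proof.
exists #|G|; apply/andP; split; first by apply/card_gt0P; exists 0.
apply/forallP => s.
pose ps (j : 'I_#|G|.+1) := \sum_(i < #|G| | (i < j)%N) tnth s i.
have /injectivePn[j1 [j2 neq12 eq12]] : ~~ injectiveb ps.
  apply/negP => /injectiveP /leq_card.
  by rewrite card_ord ltnn.
wlog lt12 : j1 j2 neq12 eq12 / (j1 < j2)%N.
  move=> H; case: (ltngtP j1 j2) => [|h|/val_inj e]; first exact: H.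
    by apply: (H j2 j1) => //; rewrite eq_sym.
  by rewrite e eqxx in neq12.
apply/existsP; exists [set i : 'I_#|G| | (j1 <= i < j2)%N]; apply/andP; split.
  have lt1 : (j1 < #|G|)%N by rewrite (leq_trans lt12) // -ltnS.
  by apply/set0Pn; exists (Ordinal lt1); rewrite inE leqnn.
have splitS : ps j2 = ps j1 + \sum_(i < #|G| | (j1 <= i < j2)%N) tnth s i.
  rewrite /ps (bigID (fun i : 'I_#|G| => (i < j1)%N)) /=; congr (_ + _).
    by apply: eq_bigl => i; case: (ltnP i j1) => h; rewrite ?andbF // andbT (ltn_trans h).
  by apply: eq_bigl => i; rewrite -leqNgt andbC.
move/eqP: splitS; rewrite -eq12 -[X in X == _]addr0 (inj_eq (addrI _)) => /eqP e0.
by rewrite [X in _ == X]e0; apply/eqP/eq_bigl => i; rewrite inE.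
Qed.

Definition davenport : nat := ex_minn davenport_exists.

End Davenport.

(* Main.v *)
Require Import Defs.
From HB Require Import structures.
From mathcomp Require Import all_boot all_order all_algebra all_fingroup all_solvable.
From mathcomp Require Import mxabelem finfield zify ring.

(** Let D_j(A/B) be the least length that forces j disjoint nonempty
    subsequences with sums in B, for subgroups B of A.  Summing the blocks found
    at one level and repeating (packs_comp) gives, along a chain of subgroups
    G > ... > N,
      D(G) <= D_j(G/N)  with  j = #|N|,
    because #|N| elements of N always contain a zero-sum block.  It is therefore
    enough to find a chain whose factors are elementary abelian groups and whose
    packing numbers are at most j |G/N| / k + k - 1.

    For k = 1 the bound is D(G) <= n.  Let k >= 2, so that G is not cyclic.  If
    the second largest invariant d of G is at least k, then G maps onto
    C_d x C_d.  There D_j <= d j + d - 1 (packs_Cd2), by induction on d from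
    Olson's case d prime, and D(G) <= n/d + d - 1 <= n/k + k - 1.

    Otherwise d < k <= 7 while n/m >= k, so G has rank at least 3 and
    2 <= d <= 6: only the sections C_2^3, C_2^4, C_3^3, C_5^3 and C_2^3 followed
    by C_2^2 or C_3^2 are needed.  In each of them D_j is bounded by greedily
    removing short zero-sum subsequences (packsS).

    Zero-sum subsequences in C_p^t come from finite differences: the indicator of
    0 in F_p^t has degree t (p - 1), so its alternating sum over all
    subsequences of a longer sequence vanishes and the empty one cannot be its
    only nonzero term.  Multiplying the indicator by a polynomial in the length
    controls the length of the subsequence found (weighted_zero_sum). *)

Set Implicit Arguments.
Unset Strict Implicit.
Unset Printing Implicit Defensive.

Import Order.TTheory GRing.Theory Num.Theory.
Local Open Scope ring_scope.

(** * Disjoint subsequences with sums in a subset *)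

Lemma perm_map_lift (T U : eqType) (f : T -> U) (s : seq T) (u : seq U) :
  perm_eq (map f s) u -> exists2 s', perm_eq s s' & map f s' = u.
Proof.
case: s => [|x0 s0]; first by rewrite perm_sym => /perm_nilP ->; exists [::].
set s := x0 :: s0; rewrite perm_sym => /(perm_iotaP (f x0)) [Is pIs ->].
exists (map (nth x0 s) Is).
  rewrite perm_sym; apply/(perm_iotaP x0); exists Is => //.
  by move: pIs; rewrite size_map.
rewrite -map_comp; apply/eq_in_map => i /=.
by rewrite (perm_mem pIs) mem_iota size_map => /andP[_ lti]; rewrite -(nth_map x0 (f x0) f lti).
Qed.

Lemma uniq_subset_perm (T : eqType) (t s : seq T) :
  uniq t -> {subset t <= s} -> exists r, perm_eq s (t ++ r).
Proof.
elim: t s => [|a t IH] s /=; first by exists s.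
case/andP=> nat ut sub; have as_ : a \in s by apply: sub; rewrite mem_head.
have /(IH _ ut) [r pr] : {subset t <= rem a s}.
  move=> x xt; have: x \in s by apply: sub; rewrite inE xt orbT.
  rewrite (perm_mem (perm_to_rem as_)) inE => /predU1P[xa|//].
  by rewrite -xa xt in nat.
by exists r; rewrite (perm_trans (perm_to_rem as_)) //= perm_cons.
Qed.

Section Packing.

Variable V : nmodType.
Implicit Types (A B C : {pred V}) (s t r : seq V).

(** For subgroups B of A, [packs A B j N] says D_j(A/B) <= N.  A subsequence is a
    block of a permutation of s; the blocks ts are disjoint and r is what
    remains. *)
Definition packs A B j N := forall s, {subset s <= A} -> (N <= size s)%N ->
  exists ts r, [/\ size ts = j, perm_eq s (flatten ts ++ r)
    & all (fun t => (t != [::]) && (\sum_(x <- t) x \in B)) ts].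

Definition has_short B l s := exists t r,
  [/\ perm_eq s (t ++ r), t != [::], (size t <= l)%N & \sum_(x <- t) x \in B].

Definition short A B L l := forall s, {subset s <= A} -> (L <= size s)%N ->
  has_short B l s.

Lemma short_exact A B L l :
  (forall s, {subset s <= A} -> size s = L -> has_short B l s) ->
  short A B L l.
Proof.
move=> H s sA Ls.
have [||t [r [pt t0 tl tB]]] := H (take L s).
- by move=> x /mem_take /sA.
- by rewrite size_takel.
exists t, (r ++ drop L s); split=> //.
by rewrite catA -[s in perm_eq s _](cat_take_drop L) perm_cat2r.
Qed.

Lemma packs_leq A B j N N' : (N <= N')%N -> packs A B j N -> packs A B j N'.
Proof. by move=> leN H s sA leNs; apply: H => //; apply: leq_trans leNs. Qed.

Lemma packs1 A B L l : short A B L l -> packs A B 1 L.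
Proof.
move=> H s sA /(H s sA) [t [r [pt t0 _ tB]]].
by exists [:: t], r; split=> //=; rewrite ?cats0 // t0 tB.
Qed.

(** Greedy step: a first block of length at most l leaves enough terms for the
    other j. *)
Lemma packsS A B L l j N N' : short A B L l -> (L <= N')%N -> (N + l <= N')%N ->
  packs A B j N -> packs A B j.+1 N'.
Proof.
move=> Hs LN' NN' Hp s sA Ns.
have [t [r [pt t0 tl tB]]] := Hs s sA (leq_trans LN' Ns).
have [||ts [r' [sts pr ats]]] := Hp r.
- by move=> x xr; apply: sA; rewrite (perm_mem pt) mem_cat xr orbT.
- rewrite -(leq_add2r l); apply: leq_trans NN' (leq_trans Ns _).
  by rewrite (perm_size pt) size_cat addnC leq_add2l.
exists (t :: ts), r'; split=> /=; first by rewrite sts.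
  by rewrite -catA (perm_trans pt) // perm_cat2l.
by rewrite t0 tB.
Qed.

(** The sums of the blocks form a sequence in B; the blocks of that sequence
    with sums in C are merged into blocks of s. *)
Lemma packs_comp A B C i j N : packs A B i N -> packs B C j i -> packs A C j N.
Proof.
move=> HAB HBC s sA Ns; have [ts [r [sts ps ats]]] := HAB s sA Ns.
pose sg t := \sum_(x <- t) x : V.
have [||us [r' [sus pu aus]]] := HBC (map sg ts).
- by move=> _ /mapP[t /(allP ats)/andP[_ tB] ->].
- by rewrite size_map sts.
have [ts' pts' def_ts'] := perm_map_lift pu.
pose n := size (flatten us).
have: map sg (take n ts') = flatten us by rewrite map_take def_ts' take_size_cat.
move: (take n ts') (drop n ts') (cat_take_drop n ts') => w w' ww' def_w.
have wts: {subset w <= ts} by move=> t tw; rewrite (perm_mem pts') -ww' mem_cat tw.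
pose ws := reshape (shape us) w.
have sz_w : size w = sumn (shape us) by rewrite -size_flatten -def_w size_map.
have mws : map (map sg) ws = us.
  by rewrite map_reshape def_w flattenK.
exists (map flatten ws), (flatten w' ++ r); split.
- by rewrite size_map -sus -mws size_map.
- rewrite (perm_trans ps) // catA perm_cat2r.
  have -> : flatten (map flatten ws) = flatten (flatten ws).
    by elim: (ws) => //= v vs ->; rewrite flatten_cat.
  rewrite reshapeKr ?sz_w // -flatten_cat ww'.
  exact: perm_flatten.
apply/allP=> _ /mapP[v vws ->].
have /(allP aus)/andP[] : map sg v \in us by rewrite -mws; apply: map_f.
rewrite big_map -size_eq0 size_map size_eq0 => v0.
rewrite big_flatten /= => ->; rewrite andbT.
case: v vws v0 => //= t v tvws _; have: t \in ts.
  apply: wts; rewrite -[w](@reshapeKr _ (shape us)) ?sz_w //.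
  by apply/flattenP; exists (t :: v); rewrite ?mem_head.
by move/(allP ats)/andP=> []; case: t {tvws}.
Qed.

End Packing.

(** * Finite differences and Olson's method *)

Section Differences.

Variables (V : nmodType) (F : comPzRingType).
Implicit Types (f g : V -> nat -> F).

(** A term v of a sequence acts on a pair (sum, length) by adding (v, 1), so only
    the differences in these directions matter. *)
Fixpoint deg_lt n f : Prop :=
  if n is n'.+1 then forall v, deg_lt n' (fun x i => f (x + v) i.+1 - f x i)
  else forall x i, f x i = 0.

Lemma eq_deg_lt n f g : (forall x i, f x i = g x i) -> deg_lt n f -> deg_lt n g.
Proof.
elim: n f g => /= [|n IH] f g fg Hf; first by move=> x i; rewrite -fg.
by move=> v; apply: IH (Hf v) => x i; rewrite !fg.
Qed.

Lemma deg_lt0 n : deg_lt n (fun _ _ => 0).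
Proof.
elim: n => //= n IH v; apply: eq_deg_lt IH => x i; by rewrite subrr.
Qed.

Lemma deg_ltD n f g :
  deg_lt n f -> deg_lt n g -> deg_lt n (fun x i => f x i + g x i).
Proof.
elim: n f g => /= [|n IH] f g Hf Hg; first by move=> x i; rewrite Hf Hg addr0.
by move=> v; apply: eq_deg_lt (IH _ _ (Hf v) (Hg v)) => x i; ring.
Qed.

Lemma deg_ltS n f : deg_lt n f -> deg_lt n.+1 f.
Proof.
elim: n f => [|n IH] f Hf v /=; first by move=> x i; rewrite !Hf subrr.
exact: IH (Hf v).
Qed.

Lemma deg_lt_shift n f v : deg_lt n f -> deg_lt n (fun x i => f (x + v) i.+1).
Proof.
move=> Hf; have Hv : deg_lt n (fun x i => f (x + v) i.+1 - f x i).
  by case: n Hf => [|n] Hf; [move=> x i; rewrite !Hf subrr | apply/deg_ltS/Hf].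
by apply: eq_deg_lt (deg_ltD Hf Hv) => x i; ring.
Qed.

(** Leibniz rule: the difference of f g is (difference of f) * (shift of g)
    + f * (difference of g). *)
Lemma deg_ltM m n f g :
  deg_lt m f -> deg_lt n g -> deg_lt (m + n).-1 (fun x i => f x i * g x i).
Proof.
move Dd: (m + n)%N => d.
elim: d m n Dd f g => [|d IH] [|m] [|n] Dd f g Hf Hg //.
- by move=> x i; rewrite Hf mul0r.
- by apply: (eq_deg_lt _ (deg_lt0 _)) => x i; rewrite Hf mul0r.
- by apply: (eq_deg_lt _ (deg_lt0 _)) => x i; rewrite Hg mulr0.
case: Dd => Dd; rewrite addnS in Dd; rewrite -Dd => v.
have Ef : (m + n.+1)%N = d by rewrite addnS.
have Eg : (m.+1 + n)%N = d by rewrite addSn.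
have := deg_ltD (IH _ _ Ef _ _ (Hf v) (deg_lt_shift v Hg)) (IH _ _ Eg _ _ Hf (Hg v)).
rewrite -Dd /=.
by apply: eq_deg_lt => x i; ring.
Qed.

Lemma deg_lt_cst c : deg_lt 1 (fun _ _ => c).
Proof. by move=> v x i; rewrite subrr. Qed.

Lemma deg_lt_additive (chi : V -> F) :
  {morph chi : x y / x + y} -> deg_lt 2 (fun x _ => chi x).
Proof. by move=> chiD v w x i; rewrite !chiD; ring. Qed.

Lemma deg_lt_nat : deg_lt 2 (fun _ i => i%:R).
Proof. by move=> v w x i; rewrite -!natr1; ring. Qed.

(** Pascal's rule: one difference lowers k by one. *)
Lemma deg_lt_bin c k : deg_lt k.+1 (fun _ i => 'C(i + c, k)%:R).
Proof.
elim: k => [|k IH] v.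
  by move=> x i; rewrite !bin0 subrr.
apply: eq_deg_lt IH => x i.
by rewrite addSn binS natrD addrC addKr.
Qed.

Lemma deg_ltX k f : deg_lt 2 f -> deg_lt k.+1 (fun x i => f x i ^+ k).
Proof.
move=> Hf; elim: k => [|k IH]; first exact: deg_lt_cst.
by apply: eq_deg_lt (deg_ltM Hf IH) => x i; rewrite exprS.
Qed.

Lemma deg_lt_1subX k f : deg_lt 2 f -> deg_lt k.+1 (fun x i => 1 - f x i ^+ k).
Proof.
move=> Hf; have deg1 : deg_lt k.+1 (fun _ _ => 1).
  by elim: k => [|k IH]; [apply: deg_lt_cst | apply: deg_ltS].
apply: eq_deg_lt (deg_ltD deg1 (deg_ltM (deg_lt_cst (-1)) (deg_ltX k Hf))) => x i.
by rewrite mulN1r.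
Qed.

Lemma deg_lt_prod (I : Type) (e : seq I) k (f : I -> V -> nat -> F) :
  (forall c, deg_lt k.+1 (f c)) ->
  deg_lt (size e * k).+1 (fun x i => \prod_(c <- e) f c x i).
Proof.
move=> Hf; elim: e => [|c e IH].
  by apply: (eq_deg_lt _ (deg_lt_cst 1)) => x i; rewrite big_nil.
have -> : (size (c :: e) * k).+1 = (k.+1 + (size e * k).+1).-1.
  by rewrite /= mulSn; lia.
by apply: eq_deg_lt (deg_ltM (Hf c) IH) => x i; rewrite big_cons.
Qed.

Fixpoint subseqs (s : seq V) : seq (seq V) :=
  if s is a :: s' then subseqs s' ++ map (cons a) (subseqs s') else [:: [::]].

Lemma mem_subseqs s t : t \in subseqs s -> subseq t s.
Proof.
elim: s t => [|a s IH] t /=; first by rewrite inE => /eqP->.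
rewrite mem_cat => /orP[/IH tsub|/mapP[u /IH usub ->]]; last by rewrite eqxx.
exact: subseq_trans tsub (subseq_cons _ _).
Qed.

Lemma big_subseqs s (h : seq V -> F) :
  \sum_(t <- subseqs s) h t = h [::] + \sum_(t <- subseqs s | t != [::]) h t.
Proof.
elim: s => [|a s IH] /=; first by rewrite !big_cons !big_nil /= addr0.
by rewrite !big_cat !big_map /= IH addrA.
Qed.

(** Up to sign, the sum is the iterated difference of f in the directions of the
    terms of s. *)
Lemma alternating_sum_eq0 f s x i : deg_lt (size s) f ->
  \sum_(t <- subseqs s) (-1) ^+ size t * f (x + \sum_(y <- t) y) (i + size t)%N
    = 0.
Proof.
elim: s f x i => [|a s IH] f x i /= Hf.
  by rewrite big_seq1 big_nil addr0 addn0 mul1r Hf.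
apply/eqP; rewrite big_cat big_map /= -big_split -oppr_eq0 -sumrN; apply/eqP.
rewrite -[RHS](IH _ x i (Hf a)).
apply: eq_bigr => t _; rewrite big_cons exprS mulN1r addnS [a + _]addrC addrA.
rewrite /=; ring.
Qed.

(** The empty subsequence contributes [f 0 0], which another term must cancel. *)
Lemma nonvanishing_subseq f s : deg_lt (size s) f -> f 0 0%N != 0 ->
  exists2 t, subseq t s
    & (t != [::]) && (f (\sum_(y <- t) y) (size t) != 0).
Proof.
move=> Hf; have := alternating_sum_eq0 0 0%N Hf; rewrite big_subseqs big_nil addr0 expr0 mul1r.
move=> sum0 f0; have /hasP[t /mem_subseqs ts tP] : has (fun t =>
    (t != [::]) && (f (\sum_(y <- t) y) (size t) != 0)) (subseqs s); last by exists t.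
apply: contraNT f0 => /hasPn noth; rewrite -sum0 big_seq_cond big1 ?addr0 //.
move=> t /andP[/noth]; rewrite negb_and => /orP[/negbTE->//|/negPn/eqP ft] _.
by rewrite add0r add0n ft mulr0.
Qed.

End Differences.

(** * Short zero-sum subsequences in elementary abelian groups *)

(** A zero-sum sequence longer than the Davenport constant splits into two
    zero-sum parts: a zero-sum subsequence avoiding the first term, and its
    complement. *)
Lemma halve_zero_sum (V : zmodType) D l (u : seq V) :
  short predT (pred1 (0 : V)) D l -> (D < size u)%N -> \sum_(x <- u) x = 0 ->
  exists t r, [/\ perm_eq u (t ++ r), t != [::], (2 * size t <= size u)%N
    & \sum_(x <- t) x = 0].
Proof.
case: u => // a u; rewrite ltnS => Hs Du sum0.
have [//|t [r [ptr t0 _ /eqP st]]] := Hs u _ Du.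
have pu : perm_eq (a :: u) (t ++ (a :: r)).
  by rewrite perm_sym perm_catC /= perm_cons perm_catC perm_sym.
have sr : \sum_(x <- a :: r) x = 0.
  by rewrite -[RHS]sum0 (perm_big _ pu) big_cat /= st add0r.
have szu : size (a :: u) = (size t + size (a :: r))%N.
  by rewrite (perm_size pu) size_cat.
case: (leqP (size t) (size (a :: r))) => tr.
  by exists t, (a :: r); split=> //; rewrite szu mul2n -addnn leq_add2l.
exists (a :: r), t; split=> //; last by rewrite szu mul2n -addnn leq_add2r ltnW.
by rewrite (perm_trans pu) // perm_catC.
Qed.

Lemma Fp_exp_pred p (a : 'F_p) : prime p -> a != 0 -> a ^+ p.-1 = 1.
Proof.
move=> pp a0; apply: (mulfI a0).
by rewrite -exprS prednK ?prime_gt0 // mulr1 -{2}(expf_card a) card_Fp.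
Qed.

Section Olson.

Variables (p t : nat).
Hypothesis pr_p : prime p.
Local Notation vT := 'rV['F_p]_t.

(** By Fermat, the product of the [1 - x_c ^+ p.-1] is the indicator of 0 and has
    degree [t * p.-1]; the weight g restricts the possible lengths. *)
Lemma weighted_zero_sum (g : nat -> 'F_p) n (s : seq vT) :
  deg_lt n (fun _ : vT => g) -> g 0%N != 0 -> size s = (n + t * p.-1)%N ->
  exists2 u, subseq u s & [/\ u != [::], \sum_(x <- u) x = 0 & g (size u) != 0].
Proof.
move=> Hg g0 szs.
pose f (x : vT) i := \prod_(c <- enum 'I_t) (1 - x 0 c ^+ p.-1) * g i.
have degf : deg_lt (size s) f.
  have -> : size s = ((size (enum 'I_t) * p.-1).+1 + n).-1.
    by rewrite size_enum_ord szs addSn addnC.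
  apply: deg_ltM Hg.
  apply: (@deg_lt_prod _ _ _ _ _ (fun c (x : vT) _ => 1 - x 0 c ^+ p.-1)) => c.
  apply/deg_lt_1subX/deg_lt_additive => x y.
  by rewrite mxE.
have p1 : (0 < p.-1)%N by have := prime_gt1 pr_p; lia.
have f0 : f 0 0%N != 0.
  rewrite /f big1 ?mul1r // => c _.
  by rewrite mxE expr0n -[p.-1]prednK //= subr0.
have [u us /andP[u0 fu]] := nonvanishing_subseq degf f0.
exists u => //; move: fu; rewrite mulf_eq0 negb_or => /andP[fu gu]; split=> //.
apply/rowP=> c; rewrite [RHS]mxE; apply/eqP/negPn/negP => xc.
case/negP: fu; rewrite prodf_seq_eq0; apply/hasP; exists c; rewrite ?mem_enum //=.
by rewrite Fp_exp_pred // subrr.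
Qed.

Lemma short_olson :
  short predT (pred1 (0 : vT)) (t * p.-1).+1 (t * p.-1).+1.
Proof.
apply: short_exact => s _ szs.
have [|||u us [u0 su _]] := @weighted_zero_sum (fun _ => 1) 1%N s.
- exact: deg_lt_cst.
- exact: oner_neq0.
- by rewrite szs add1n.
have [r pr] := perm_to_subseq us; exists u, r; split=> //; last exact/eqP.
by rewrite -szs size_subseq.
Qed.

End Olson.

(** The weight [1 - i ^+ p.-1] selects lengths divisible by p, hence p or 2p;
    length 2p exceeds D(C_p^2) = 2p - 1, so such a subsequence can be halved. *)
Lemma short_rank2 p : prime p ->
  short predT (pred1 (0 : 'rV['F_p]_2)) (3 * p - 2) p.
Proof.
move=> pp; have p1 := prime_gt1 pp.
apply: short_exact => s _ szs.
have [|||u us [u0 su gu]] := @weighted_zero_sum p 2 pp (fun i => 1 - i%:R ^+ p.-1) p.-1.+1 s.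
- exact/deg_lt_1subX/deg_lt_nat.
- by rewrite mulr0n expr0n gtn_eqF ?subr0 ?oner_neq0 // -subn1 subn_gt0.
- by rewrite szs; lia.
have [r pr] := perm_to_subseq us.
have pu : (p %| size u)%N.
  rewrite (dvdn_pcharf (pchar_Fp pp)); apply/negPn/negP=> nz.
  by rewrite Fp_exp_pred // subrr eqxx in gu.
have szu : (size u <= 3 * p - 2)%N by rewrite -szs size_subseq.
case: (leqP (size u) p) => up; first by exists u, r; split=> //; apply/eqP.
have szu2 : size u = (2 * p)%N.
  by case/dvdnP: pu => q qE; move: szu up; rewrite qE; case: q qE => [|[|[|q]]] _; nia.
have [|v [w [puv v0 szv sv]]] := halve_zero_sum (@short_olson p 2 pp) _ su.
  by rewrite szu2; lia.
exists v, (w ++ r); split=> //; last exact/eqP.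
  by rewrite catA (perm_trans pr) // perm_cat2r.
by move: szv; rewrite szu2 leq_pmul2l.
Qed.

Lemma nseq_perm (T : eqType) k (a : T) s :
  (k <= count_mem a s)%N -> exists r, perm_eq s (nseq k a ++ r).
Proof.
elim: k s => [|k IH] s kc; first by exists s.
have /perm_to_rem ps : a \in s by rewrite -has_pred1 has_count; lia.
have [|r pr] := IH (rem a s).
  by move/seq.permP: ps kc => /(_ (pred1 a)) /= ->; rewrite eqxx.
by exists r; rewrite (perm_trans ps) //= perm_cons.
Qed.

Lemma sum_count_mem (T : finType) (s : seq T) :
  (\sum_v count_mem v s)%N = size s.
Proof.
elim: s => [|a s IH] /=; first by rewrite big1.
by rewrite big_split /= IH (bigD1 a) //= eqxx big1 // => v /negbTE; rewrite eq_sym => ->.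
Qed.

Lemma short_mem0 (V : nmodType) (s : seq V) l : (0 < l)%N -> 0 \in s ->
  has_short (pred1 0) l s.
Proof.
move=> l0 s0; exists [:: 0], (rem 0 s); rewrite perm_to_rem //=.
by rewrite big_seq1 inE.
Qed.

(** Without 0 and without repetition, a sequence has fewer than #|V| terms. *)
Lemma short_char2_pair (V : finZmodType) : (forall x : V, x + x = 0) ->
  short predT (pred1 (0%R : V)) #|V| 2.
Proof.
move=> V2 s _ szs; have [s0|s0] := boolP (0 \in s); first exact: short_mem0.
have [/existsP[a /nseq_perm[r pr]]|] := boolP [exists a, 1 < count_mem a s]%N.
  by exists (nseq 2 a), r; split=> //; rewrite inE /= big_cons big_seq1 V2.
rewrite negb_exists => /forallP cs; move: szs; rewrite -sum_count_mem.
rewrite (bigD1 0) //= (count_memPn s0) add0n leqNgt => /negP[].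
apply: (@leq_ltn_trans #|predC1 (0%R : V)|).
  by rewrite -sum1_card; apply: leq_sum => v _; rewrite leqNgt.
by rewrite cardC1 prednK //; apply/card_gt0P; exists 0.
Qed.

(** If s has distinct nonzero terms and a is one of them, then s and a + s are
    too large to be disjoint, and a common point a + b = c gives a + b + c = 0. *)
Lemma short_char2_triple (V : finZmodType) L : (forall x : V, x + x = 0) ->
  (#|V| < 2 * L)%N -> short predT (pred1 (0%R : V)) L 3.
Proof.
move=> V2 VL s _ szs; have [s0|s0] := boolP (0 \in s); first exact: short_mem0.
have [us|nus] := boolP (uniq s); last first.
  have [a ca] : exists a, (1 < count_mem a s)%N.
    apply/existsP; apply: contraNT nus; rewrite negb_exists => /forallP cs.
    apply: count_mem_uniq => a; have := cs a; rewrite -leqNgt -has_pred1 has_count.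
    by case: (count_mem a s) => [|[]].
  have [r pr] := nseq_perm ca.
  by exists (nseq 2 a), r; split=> //; rewrite inE /= big_cons big_seq1 V2.
case: s us szs s0 => [|a s] us szs s0; first by rewrite leqn0 in szs; lia.
pose A := [set x in a :: s]; pose B := [set a + x | x in A].
have cA : #|A| = size (a :: s) by rewrite cardsE; apply/card_uniqP.
have cB : #|B| = #|A| by apply: card_imset; apply: addrI.
have /set0Pn[c] : A :&: B != set0.
  apply: contraTneq VL => AB0; have := cardsUI A B.
  rewrite AB0 cards0 addn0 cB cA => cU; rewrite -leqNgt.
  by apply: leq_trans (max_card (mem (A :|: B))); rewrite cU mul2n -addnn leq_add.
rewrite !inE -[(c == a) || _]in_cons => /andP[cs /imsetP[b]].
rewrite inE => bs def_c.
have nz x : x \in a :: s -> x != 0 by move=> xs; apply: contraNneq s0 => <-.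
have [|x|r pr] := @uniq_subset_perm _ [:: a; b; c] (a :: s).
- rewrite /= !inE andbT negb_or -!andbA; apply/and3P; split.
  + by apply: contraNneq (nz c cs) => ab; rewrite def_c -ab V2.
  + by apply: contraNneq (nz b bs) => ac; apply/eqP/(addrI a); rewrite -def_c addr0.
  + apply: contraNneq (nz a (mem_head a s)) => bc; apply/eqP/(addIr b).
    by rewrite -def_c add0r.
- by rewrite !inE => /or3P[] /eqP->; rewrite -?in_cons ?mem_head.
exists [:: a; b; c], r; split=> //.
by rewrite inE 2!big_cons big_seq1 addrA -def_c V2.
Qed.

(** Unless there is a zero-sum subsequence of the form 0, (a, -a) or (a, a, a),
    each v <> 0 has at most two occurrences of v and -v together; summing over v
    counts s twice. *)
Lemma short_char3_triple (V : finZmodType) : (forall x : V, x *+ 3 = 0) ->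
  short predT (pred1 (0%R : V)) #|V| 3.
Proof.
move=> V3 s _ szs; have [s0|s0] := boolP (0 \in s); first exact: short_mem0.
have [/existsP[a /nseq_perm[r pr]]|] := boolP [exists a, 2 < count_mem a s]%N.
  exists (nseq 3 a), r; split=> //; rewrite inE /= 2!big_cons big_seq1.
  by rewrite -(V3 a) !mulrS mulr0n addr0.
rewrite negb_exists => /forallP cs.
have [/existsP[a /andP[aN /andP[ca cNa]]]|] :=
    boolP [exists a, [&& a != - a, 0 < count_mem a s & 0 < count_mem (- a) s]]%N.
  have [|x|r pr] := @uniq_subset_perm _ [:: a; - a] s.
  - by rewrite /= inE aN.
  - by rewrite !inE => /orP[] /eqP->; rewrite -has_pred1 has_count.
  by exists [:: a; - a], r; split=> //; rewrite inE big_cons big_seq1 subrr.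
rewrite negb_exists => /forallP ns.
have V0 : (0 < #|V|)%N by apply/card_gt0P; exists 0.
have: (2 * size s <= 2 * #|predC1 (0%R : V)|)%N.
  have -> : (2 * size s = \sum_v (count_mem v s + count_mem (- v) s))%N.
    rewrite big_split /= sum_count_mem mul2n -addnn; congr addn.
    by rewrite -(sum_count_mem s) (reindex_inj oppr_inj).
  rewrite (bigD1 0) //= oppr0 (count_memPn s0) add0n mulnC -sum_nat_const.
  apply: leq_sum => v v0; have := ns v; have := cs v; have := cs (- v).
  have -> : v != - v.
    apply: contraNneq v0 => vN; have vv : v + v = 0 by rewrite {1}vN addNr.
    by rewrite -[X in _ == X](V3 v) mulrS mulr2n vv addr0.
  by move: (count_mem v s) (count_mem (- v) s) => m n; lia.
by rewrite leq_pmul2l // cardC1 => le; move: (leq_trans szs le); rewrite -ltnS prednK // ltnn.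
Qed.

(** The length weight below has degree 5 and vanishes mod 3 at 5, 6, 7, 10 and
    11, but not at 0.  A zero-sum subsequence of length 8 or 9 has more than
    D(C_3^3) = 7 terms and can be halved.  So the subsequence found has length
    at most 4, can be halved, or is s itself. *)
Lemma short_or_zero_sum_F3 (s : seq 'rV['F_3]_3) : size s = 12%N ->
  has_short (pred1 0) 4 s
  \/ \sum_(x <- s) x = 0.
Proof.
move=> szs.
pose g i : 'F_3 := 'C(i + 4, 3)%:R * 'C(i + 2, 2)%:R.
have degg : deg_lt 6 (fun _ : 'rV['F_3]_3 => g).
  exact: (deg_ltM (@deg_lt_bin _ 'F_3 4 3) (@deg_lt_bin _ 'F_3 2 2)).
have [u us [u0 su gu]] := @weighted_zero_sum 3 3 isT g 6 s degg isT szs.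
have [r pr] := perm_to_subseq us.
have szu : (size u <= 12)%N by rewrite -szs size_subseq.
have [u4|u4] := leqP (size u) 4.
  by left; exists u, r; split=> //; apply/eqP.
have [u89|nu89] := boolP (size u \in [:: 8; 9])%N.
  have [|v [w [puv v0 szv sv]]] := halve_zero_sum (@short_olson 3 3 isT) _ su.
    by move: u89; rewrite !inE => /orP[] /eqP->.
  left; exists v, (w ++ r); split=> //; last exact/eqP.
    by rewrite catA (perm_trans pr) // perm_cat2r.
  by rewrite -ltnS -(ltn_pmul2l (isT : (0 < 2)%N)) (leq_ltn_trans szv) //;
    move: u89; rewrite !inE => /orP[] /eqP->.
right; have [u12|u12] := leqP 12 (size u).
  suff <- : u = s by [].
  by apply/eqP; rewrite -(size_subseq_leqif us) eqn_leq szs szu.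
have {gu} : ~~ (3 %| 'C(size u + 4, 3))%N && ~~ (3 %| 'C(size u + 2, 2))%N.
  by move: gu; rewrite /g mulf_eq0 negb_or -!(dvdn_pcharf (@pchar_Fp 3 isT)).
have : size u \in [:: 5; 6; 7; 10; 11]%N.
  by move: u4 nu89 u12; rewrite !inE; move: (size u) => n; lia.
by rewrite !inE => /or4P[||| /orP[]] /eqP->.
Qed.

(** If removing any single term leaves sum 0, then all terms are equal, and three
    of them form a zero-sum sequence. *)
Lemma short_of_coatoms (V : zmodType) n l : (2 < l)%N -> (forall x : V, x *+ 3 = 0) ->
  (forall s : seq V, size s = n.+2 ->
    has_short (pred1 0) l s
    \/ \sum_(x <- s) x = 0) ->
  short predT (pred1 (0 : V)) n.+3 l.
Proof.
move=> l2 V3 Hs; apply: short_exact => -[|a [|b [|c s]]] // _ [szs].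
have pb : perm_eq [:: a, b, c & s] [:: b, a, c & s] by rewrite (perm_catCA [:: a] [:: b]).
have pc : perm_eq [:: a, b, c & s] [:: c, a, b & s].
  by rewrite (perm_catCA [:: a; b] [:: c]).
have lift x s' : perm_eq [:: a, b, c & s] (x :: s') -> size s' = n.+2 ->
    has_short (pred1 0) l [:: a, b, c & s]
    \/ \sum_(y <- s') y = 0.
  move=> ps' /Hs[[t [r [ptr t0 t4 st]]]|]; [left | by right].
  exists t, (x :: r); split=> //; rewrite (perm_trans ps') //.
  by rewrite perm_sym perm_catC /= perm_cons perm_catC perm_sym.
have sz y z : size [:: y, z & s] = n.+2 by rewrite /= szs.
have [//|sa] := lift a _ (perm_refl _) (sz b c).
have [//|sb] := lift b _ pb (sz a c).
have [//|sc] := lift c _ pc (sz a b).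
move: sa sb sc; rewrite !big_cons => sa sb sc.
have ab : a = b by apply: (@addIr _ (c + \sum_(j <- s) j)); rewrite sa sb.
have ac : a = c.
  by apply: (@addIr _ (b + \sum_(j <- s) j)); rewrite sc addrCA sa.
exists [:: a; b; c], s; split=> //; rewrite inE -ab -ac 2!big_cons big_seq1.
by rewrite -(V3 a) !mulrS mulr0n addr0.
Qed.

Lemma mulrn_rV_Fp p t (x : 'rV['F_p]_t) : prime p -> x *+ p = 0.
Proof.
by move=> pp; apply/rowP => c; rewrite mulmxnE mxE -mulr_natr pchar_Fp_0 ?mulr0.
Qed.

Lemma short_F3_rank3 : short predT (pred1 (0 : 'rV['F_3]_3)) 13 4.
Proof.
apply: short_of_coatoms => // [x|]; first exact: mulrn_rV_Fp.
exact: short_or_zero_sum_F3.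
Qed.

Lemma short_morph (V W : zmodType) (A B : {pred V}) (phi : V -> W) L l :
  0 \in A -> {in A &, forall x y, x + y \in A} ->
  {in A &, {morph phi : x y / x + y}} ->
  {in A, forall x, phi x = 0 -> x \in B} ->
  short predT (pred1 (0 : W)) L l -> short A B L l.
Proof.
move=> A0 AD phiD phiB Hs s sA Ls.
have phi0 : phi 0 = 0 by apply: (@addrI _ (phi 0)); rewrite -phiD // !addr0.
have [//||u [r [pu u0 ul /eqP su]]] := Hs (map phi s); first by rewrite size_map.
have [s' ps' def_s'] := perm_map_lift pu.
pose t := take (size u) s'; have def_u : map phi t = u.
  by rewrite map_take def_s' take_size_cat.
have tA : {subset t <= A}.
  by move=> x /mem_take; rewrite -(perm_mem ps') => /sA.
have [stA phis] : \sum_(x <- t) x \in A /\ phi (\sum_(x <- t) x) = \sum_(x <- u) x.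
  rewrite -def_u; elim: (t) tA => [|a t' IH] tA; first by rewrite !big_nil.
  have [|sA' eqs] := IH _; first by move=> x xt; apply: tA; rewrite inE xt orbT.
  have aA : a \in A by apply: tA; rewrite mem_head.
  by rewrite /= !big_cons phiD // eqs AD.
exists t, (drop (size u) s'); rewrite cat_take_drop; split=> //.
- by rewrite -size_eq0 -(size_map phi) def_u size_eq0.
- by rewrite -(size_map phi) def_u.
by apply: phiB => //; rewrite phis.
Qed.

(** * Elementary abelian sections *)

(** For abelian A and prime p: A / B is elementary abelian of order p ^ t. *)
Definition pcut (gT : finGroupType) p t (A B : {group gT}) :=
  [/\ B \subset A, #|A| = (p ^ t * #|B|)%N & {in A, forall a, (a ^+ p)%g \in B}].

Section Cuts.

Variable gT : finGroupType.
Implicit Types (A B R : {group gT}) (x : gT).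

Lemma pcut_refl p R : pcut p 0 R R.
Proof. by split=> [||a aR]; rewrite ?mul1n ?groupX. Qed.

Lemma pcut_cycle p t x R R' A :
  (0 < p)%N -> (<[x]> \x R)%g = A -> (p %| #[x]%g)%N -> pcut p t R R' ->
  exists2 A' : {group gT}, (<[x ^+ p]> \x R')%g = A' & pcut p t.+1 A A'.
Proof.
move=> p0 defA px [sR'R cR pR]; have [_ mA cxR tiR] := dprodP defA.
have sxp : (<[x ^+ p]> \subset <[x]>)%g by rewrite cycle_subG mem_cycle.
have cx' : (R' \subset 'C(<[x ^+ p]>))%g.
  exact: subset_trans sR'R (subset_trans cxR (centS sxp)).
have ti' : (<[x ^+ p]> :&: R' = 1)%g.
  by apply/trivgP; rewrite /= -tiR setISS.
have def' := dprodE cx' ti'.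
have gset : group_set (<[x ^+ p]> * R')%g.
  by rewrite -(cent_joinEr cx') groupP.
pose A' := Group gset; exists A' => //.
have cA' : #|A'| = (#[x ^+ p]%g * #|R'|)%N by rewrite -(@dprod_card _ _ _ A' def').
split=> /=.
- by rewrite -mA mulgSS.
- rewrite cA' -(dprod_card defA) cR orderXdiv // -orderE expnS.
  move: (divnK px); move: (#[x]%g %/ p)%N => q <-; lia.
move=> a; rewrite -mA => /mulsgP[_ r /cycleP[i ->] rR ->].
have cxr : commute (x ^+ i) r.
  by apply/commute_sym/(centsP cxR) => //; apply: mem_cycle.
rewrite expgMn // mem_mulg ?pR //.
by rewrite -expgM mulnC expgM mem_cycle.
Qed.

(** Coordinates on A / B as a vector space over F_p, so that zero-sum results
    over 'rV['F_p]_t apply to sums in B. *)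
Lemma pcut_coords p t A B : prime p -> abelian A -> pcut p t A B ->
  exists phi : gT -> 'rV['F_p]_t,
    {in A &, forall x y, phi (x * y)%g = phi x + phi y}
    /\ {in A, forall x, phi x = 0 -> x \in B}.
Proof.
move=> pp abA [sBA cA pA].
have nBA : (A \subset 'N(B))%g by rewrite (subset_trans abA) // (subset_trans (centS sBA)) // cent_sub.
have cQ : #|A / B|%g = (p ^ t)%N.
  rewrite card_quotient //; have := Lagrange sBA; rewrite cA mulnC => /eqP.
  by rewrite eqn_pmul2r ?cardG_gt0 // => /eqP.
case: t => [|t] in cA cQ *.
  exists (fun _ => 0); split=> [x y _ _|x xA _]; first by rewrite addr0.
  have /eqP-> : B :==: A by rewrite eqEcard sBA cA mul1n leqnn.
  by [].
have abE : (p.-abelem (A / B))%g.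
  rewrite abelemE // quotient_abelian //=; apply/exponentP => _ /morphimP[x nx xA ->].
  by rewrite -morphX //= coset_id // pA.
have ntE : (A / B != 1)%g by rewrite -cardG_gt1 cQ -(exp1n t.+1) ltn_exp2r ?prime_gt1.
have dE : ('dim (A / B) = t.+1)%g.
  by rewrite (dim_abelemE abE ntE) cQ pfactorK.
pose psi := abelem_rV abE ntE.
exists (fun x => castmx (erefl, dE) (psi (coset B x))).
have sN x : x \in A -> x \in 'N(B)%g by apply/subsetP.
split=> [x y xA yA|x xA].
  rewrite morphM ?sN // [psi _]abelem_rV_M ?mem_quotient //.
  by case: _ / dE.
move/(canRL (castmxK _ _)); rewrite (castmx_const) => psi0.
apply: coset_idr; first exact: sN.
have := @abelem_rV_inj _ _ _ abE ntE (coset B x) 1%g.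
by rewrite group1 mem_quotient // abelem_rV_1 => /(_ isT isT psi0).
Qed.

End Cuts.

(** * Numerical comparisons *)

(** With c = #|N| and I the index of N in G, the comparisons below read
    k * b <= I * c + k * (k - 1), where b is the bound used for D_c(G/N); this is
    the target inequality multiplied by k. *)
Lemma bound_rank2 k d c : (k <= d)%N -> (0 < c)%N ->
  (k * (d * c + d - 1) <= d ^ 2 * c + k * k.-1)%N.
Proof.
case: k => // k kd c0; have [e def_d] : exists e, d = (k.+1 + e)%N by exists (d - k.+1)%N; lia.
have [f def_c] : exists f, c = f.+1 by exists c.-1; lia.
subst; nia.
Qed.

Lemma bound_2rank3_one k : (2 < k <= 4)%N -> (k * 4 <= 2 ^ 3 * 1 + k * k.-1)%N.
Proof. by case: k => [|[|[|[|[|k]]]]]. Qed.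

Lemma bound_2rank3 k c : (2 < k <= 4)%N -> (1 < c)%N ->
  (k * (2 * c + 3) <= 2 ^ 3 * c + k * k.-1)%N.
Proof. by case: k => [|[|[|[|[|k]]]]] // _; lia. Qed.

Lemma bound_2rank4_small k c : (2 < k <= 7)%N -> (0 < c <= 4)%N ->
  (k * (3 * c + 3) <= 2 ^ 4 * c + k * k.-1)%N.
Proof. by case: k => [|[|[|[|[|[|[|[|k]]]]]]]] // _; lia. Qed.

Lemma bound_2rank4_large k c : (2 < k <= 7)%N -> (4 <= c)%N ->
  (k * (2 * c + 7) <= 2 ^ 4 * c + k * k.-1)%N.
Proof. by case: k => [|[|[|[|[|[|[|[|k]]]]]]]] // _; lia. Qed.

Lemma bound_2rank3_rank2 k d c : (1 < d)%N -> (2 * d < k <= 7)%N -> (0 < c)%N ->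
  (k * (2 * (d * c + d - 1) + 3) <= 2 ^ 3 * d ^ 2 * c + k * k.-1)%N.
Proof.
case: d => [|[|[|[|d]]]] // _; last by lia.
  by case: k => [|[|[|[|[|[|[|[|k]]]]]]]] // _; lia.
by case: k => [|[|[|[|[|[|[|[|k]]]]]]]] // _; lia.
Qed.

Lemma bound_3rank3_small k c : (3 < k <= 7)%N -> (0 < c <= 7)%N ->
  (k * (4 * c + 5) <= 3 ^ 3 * c + k * k.-1)%N.
Proof. by case: k => [|[|[|[|[|[|[|[|k]]]]]]]] // _; lia. Qed.

Lemma bound_3rank3_large k c : (3 < k <= 7)%N -> (7 <= c)%N ->
  (k * (3 * c + 12) <= 3 ^ 3 * c + k * k.-1)%N.
Proof. by case: k => [|[|[|[|[|[|[|[|k]]]]]]]] // _; lia. Qed.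

Lemma bound_5rank3 k c : (5 < k <= 7)%N ->
  (k * (c * (3 * 5.-1).+1) <= 5 ^ 3 * c + k * k.-1)%N.
Proof. by case: k => [|[|[|[|[|[|[|[|k]]]]]]]] // _; lia. Qed.

(** * Packing in sections of a finite abelian group *)

Section Chains.

Variable G : finZmodType.
Implicit Types (A B C R : {group G}) (x y z : G).

Lemma pcut_short p t A B L l : prime p -> pcut p t A B ->
  short predT (pred1 (0 : 'rV['F_p]_t)) L l -> short A B L l.
Proof.
move=> pp cAB; have abA : abelian A by apply/centsP => x _ y _; apply: addrC.
have [phi [phiD phiB]] := pcut_coords pp abA cAB.
apply: (@short_morph _ _ _ _ phi); first exact: group1.
- by move=> x y; apply: groupM.
- exact: phiD.
- exact: phiB.
Qed.

(** D(C_p^2) = 2p - 1, then blocks of length at most p. *)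
Lemma packs_rank2 p j A B : prime p -> pcut p 2 A B -> (0 < j)%N ->
  packs A B j (p * j + p - 1).
Proof.
move=> pp cAB; case: j => // j _; have p1 := prime_gt1 pp.
elim: j => [|j IH].
  apply: packs_leq (packs1 (pcut_short pp cAB (short_olson pp))); nia.
by apply: (packsS (pcut_short pp cAB (short_rank2 pp)) _ _ IH); nia.
Qed.

Lemma pcut2_short t A B : pcut 2 t A B -> short A B (2 ^ t) 2.
Proof.
move=> cAB; apply: (pcut_short _ cAB) => //.
have V2 (x : 'rV['F_2]_t) : x + x = 0 by rewrite -mulr2n mulrn_rV_Fp.
have := short_char2_pair V2.
by rewrite card_mx card_Fp // mul1n.
Qed.

Lemma pcut2_short3 t L A B : (2 ^ t < 2 * L)%N -> pcut 2 t A B -> short A B L 3.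
Proof.
move=> tL cAB; apply: (pcut_short _ cAB) => //.
apply: short_char2_triple => [x|]; first by rewrite -mulr2n mulrn_rV_Fp.
by rewrite card_mx card_Fp // mul1n.
Qed.

(** Sharper than [2 * j + 3] at j = 1; needed for G = C_2^3 and k = 3. *)
Lemma packs_2rank3_one A B : pcut 2 3 A B -> packs A B 1 4.
Proof. move=> cAB; exact: (packs1 (pcut_short _ cAB (@short_olson 2 3 isT))). Qed.

(** The second block has length at most 3, the later ones at most 2. *)
Lemma packs_2rank3 j A B : pcut 2 3 A B -> (0 < j)%N -> packs A B j (2 * j + 3).
Proof.
case: j => // j cAB _; case: j => [|j].
  by apply: packs_leq (packs_2rank3_one cAB).
elim: j => [|j IH].
  by apply: (packsS (@pcut2_short3 3 5 _ _ isT cAB) _ _ (packs_2rank3_one cAB)).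
by apply: (packsS (pcut2_short cAB) _ _ IH); lia.
Qed.

(** Nine terms force a block of length at most 3; from length 16 on, blocks of
    length at most 2 are available, which makes [packs_2rank4_large] cheaper. *)
Lemma packs_2rank4_small j A B : pcut 2 4 A B -> (0 < j)%N -> packs A B j (3 * j + 3).
Proof.
case: j => // j cAB _; elim: j => [|j IH].
  exact: packs_leq (packs1 (pcut_short _ cAB (@short_olson 2 4 isT))).
by apply: (packsS (@pcut2_short3 4 9 _ _ isT cAB) _ _ IH); lia.
Qed.

Lemma packs_2rank4_large j A B : pcut 2 4 A B -> (4 <= j)%N -> packs A B j (2 * j + 7).
Proof.
move=> cAB; elim: j => // j IH; rewrite leq_eqVlt => /predU1P[<-|j4].
  exact: packs_leq (packs_2rank4_small cAB _).
by apply: (packsS (pcut2_short cAB) _ _ (IH j4)); lia.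
Qed.

(** Thirteen terms force a block of length at most 4; from length 27 on, blocks
    of length at most 3 are available, as used in [packs_3rank3_large]. *)
Lemma packs_3rank3_small j A B : pcut 3 3 A B -> (0 < j)%N -> packs A B j (4 * j + 5).
Proof.
case: j => // j cAB _; elim: j => [|j IH].
  exact: packs_leq (packs1 (pcut_short _ cAB (@short_olson 3 3 isT))).
by apply: (packsS (pcut_short (isT : prime 3) cAB short_F3_rank3) _ _ IH); lia.
Qed.

Lemma packs_3rank3_large j A B : pcut 3 3 A B -> (7 <= j)%N -> packs A B j (3 * j + 12).
Proof.
move=> cAB; elim: j => // j IH; rewrite leq_eqVlt => /predU1P[<-|j7].
  exact: packs_leq (packs_3rank3_small cAB _).
have s27 : short A B 27 3.
  apply: (pcut_short _ cAB) => //.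
  have := short_char3_triple (fun x : 'rV['F_3]_3 => mulrn_rV_Fp x isT).
  by rewrite card_mx card_Fp.
by apply: (packsS s27 _ _ (IH j7)); lia.
Qed.

Lemma packs_rank3_mul p j A B : prime p -> pcut p 3 A B ->
  packs A B j (j * (3 * p.-1).+1).
Proof.
move=> pp cAB; elim: j => [|j IH]; first by move=> s _ _; exists [::], s.
apply: (packsS (pcut_short pp cAB (short_olson pp)) _ _ IH); first exact: leq_addr.
by rewrite mulSn addnC.
Qed.

Lemma packs_id j A : packs A A j j.
Proof.
move=> s sA js; exists [seq [:: x] | x <- take j s], (drop j s).
rewrite size_map size_takel // flatten_seq1 cat_take_drop; split=> //.
apply/allP=> _ /mapP[x /mem_take/sA xA ->] /=.
by rewrite big_seq1.
Qed.

(** Induction on d: for a prime p dividing d, replace x and y by their p-th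
    powers.  This is a section C_p^2, and the subgroup obtained has the same
    form for d / p. *)
Lemma packs_Cd2 d A R x y : (<[x]> \x (<[y]> \x R))%g = A ->
    (0 < d)%N -> (d %| #[x]%g)%N -> (d %| #[y]%g)%N ->
  exists2 C : {group G}, #|A| = (d ^ 2 * #|C|)%N
    & forall j, (0 < j)%N -> packs A C j (d * j + d - 1).
Proof.
elim/ltn_ind: d A x y => d IH A x y defA d0 dx dy.
have [d1|d1] := leqP d 1.
  have -> : d = 1%N by lia.
  by exists A => [|j _]; rewrite ?mul1n // addnK; apply: packs_id.
pose p := pdiv d; have pp : prime p := pdiv_prime d1.
have def_d : (d %/ p * p)%N = d := divnK (pdiv_dvd d).
set e := (d %/ p)%N in def_d.
have p1 := prime_gt1 pp.
have e0 : (0 < e)%N by move: d0; rewrite -def_d muln_gt0 => /andP[].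
have [Y defY] : exists Y : {group G}, (<[y]> \x R)%g = Y.
  by have [[_ Y _ ->] _ _ _] := dprodP defA; exists Y.
rewrite defY in defA.
have py : (p %| #[y]%g)%N by rewrite (dvdn_trans (pdiv_dvd d)).
have px : (p %| #[x]%g)%N by rewrite (dvdn_trans (pdiv_dvd d)).
have [Y' defY' cY] := pcut_cycle (ltnW p1) defY py (pcut_refl p R).
have [B defB cAB] := pcut_cycle (ltnW p1) defA px cY.
rewrite -defY' in defB.
have [|||C cBC pBC] := IH e _ _ _ _ defB e0.
- by rewrite -def_d; nia.
- by rewrite orderXdiv // -(dvdn_pmul2r (ltnW p1)) def_d divnK.
- by rewrite orderXdiv // -(dvdn_pmul2r (ltnW p1)) def_d divnK.
exists C => [|j j0].
  by have [_ -> _] := cAB; rewrite cBC -def_d expnMn; ring.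
have ej : (1 < e * j + e)%N by rewrite addnC -mulnS (leq_trans _ (leq_pmull j.+1 e0)).
have pAB : (0 < e * j + e - 1)%N by rewrite subn_gt0.
apply: packs_leq (packs_comp (packs_rank2 pp cAB pAB) (pBC j j0)).
rewrite -def_d mulnBr muln1 subnK; first by apply: leq_sub2r; lia.
by rewrite -{1}[p]muln1 leq_mul2l ltnW ?orbT.
Qed.

(** * The Davenport constant *)

(** Two of the #|N| + 1 partial sums coincide. *)
Lemma short_card (N : {group G}) : short N (pred1 (0 : G)) #|N| #|N|.
Proof.
apply: short_exact => s sN szs.
pose ps (i : 'I_#|N|.+1) := \sum_(x <- take i s) x.
have psN i : ps i \in N.
  rewrite /ps big_seq; apply: (@big_ind _ (fun x : G => x \in N)) => [||x /mem_take/sN//].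
  - exact: group1.
  - exact: groupM.
have /injectivePn[i1 [i2 neq12 eq12]] : ~~ injectiveb ps.
  apply/negP => /injectiveP inj_ps; have cI := card_imset setT inj_ps.
  have : (#|ps @: setT| <= #|N|)%N.
    by apply/subset_leq_card/subsetP => _ /imsetP[i _ ->].
  by rewrite cI cardsT card_ord ltnn.
wlog lt12 : i1 i2 neq12 eq12 / (i1 < i2)%N.
  move=> H; case: (ltngtP i1 i2) => [|h|/val_inj e]; first exact: H.
    by apply: (H i2 i1) => //; rewrite eq_sym.
  by rewrite e eqxx in neq12.
have i2N : (i2 <= #|N|)%N by rewrite -ltnS.
pose t := drop i1 (take i2 s).
have split2 : take i2 s = take i1 s ++ t.
  by rewrite -{1}(cat_take_drop i1 (take i2 s)) take_takel // ltnW.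
have szt : size t = (i2 - i1)%N by rewrite size_drop size_takel // szs.
exists t, (take i1 s ++ drop i2 s); split.
- by rewrite -{1}(cat_take_drop i2 s) split2 -catA perm_catCA.
- by rewrite -size_eq0 szt subn_eq0 -ltnNge.
- by rewrite szt; lia.
rewrite inE; apply/eqP/(addrI (ps i1)); rewrite addr0 {2}eq12 /ps split2.
by rewrite big_cat.
Qed.

Lemma davenport_packs d : packs predT (pred1 (0 : G)) 1 d -> (davenport G <= d)%N.
Proof.
move=> Hd; rewrite /davenport; case: ex_minnP => D _ minD; apply: minD.
apply/andP; split.
  case: d Hd => // /(_ [::]) [//|//|ts [r [sts]]].
  by case: ts sts => [|[|a t] [|//]] //= _; rewrite perm_sym => /perm_nilP.
apply/forallP => s; have [//||ts [r [sts ps ats]]] := Hd s; first by rewrite size_tuple.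
case: ts sts ps ats => [|t [|//]] // _; rewrite /= cats0 andbT.
rewrite -{1}[val s](map_tnth_enum s) => /perm_map_lift[I pI def_I] /andP[t0 /eqP st].
pose J := take (size t) I; have def_J : map (tnth s) J = t.
  by rewrite map_take def_I take_size_cat.
have uJ : uniq J by rewrite take_uniq // -(perm_uniq pI) enum_uniq.
apply/existsP; exists [set i in J]; apply/andP; split.
  case: J def_J uJ => [|i J'] def_J _; first by rewrite -def_J in t0.
  by apply/set0Pn; exists i; rewrite inE mem_head.
apply/eqP; rewrite -[RHS]st -def_J big_map big_uniq //=.
by apply: eq_bigl => i; rewrite inE.
Qed.

Lemma davenport_chain (N : {group G}) b :
  packs [set: G] N #|N| b -> (davenport G <= b)%N.
Proof.
move=> Hb; apply: davenport_packs => s _ bs.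
have [//|ts [r H]] := packs_comp Hb (packs1 (@short_card N)) _ bs; first by move=> x; rewrite inE.
by exists ts, r.
Qed.

Lemma davenport_le_of_packs k I (N : {group G}) b :
    packs [set: G] N #|N| b -> #|G| = (I * #|N|)%N ->
    (k * b <= I * #|N| + k * k.-1)%N ->
  (k * davenport G <= #|G| + k * k.-1)%N.
Proof.
move=> Hb cG; rewrite cG; apply: leq_trans.
by rewrite leq_mul2l (davenport_chain Hb) orbT.
Qed.

Lemma davenport_leq_card : (davenport G <= #|G|)%N.
Proof.
by have := davenport_chain (@packs_id #|[set: G]%G| [set: G]%G); rewrite /= cardsT.
Qed.

(** The cyclic factors <[x]>, <[y]>, <[z]>, ... of G have orders each dividing
    the previous one.  From #[x] <= exponent G <= n / k, the orders other
    than #[x] have product at least k.  If k <= #[y], the quotient C_d^2 with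
    d = #[y] suffices.  Otherwise #[y] <= 6 and z exists; the order of z is even,
    3 or 5, and for even #[z] one distinguishes #[y] = 2 from #[y] = 4 or 6. *)
Lemma davenport_bound k : (0 < k <= 7)%N -> (k * exponent [set: G] <= #|G|)%N ->
  (k * davenport G <= #|G| + k * k.-1)%N.
Proof.
case/andP=> k0 k7 kexp; case: (ltngtP k 1) => [|k1|->]; first by lia.
  2: by rewrite !mul1n addn0 davenport_leq_card.
have abG : abelian [set: G] by apply/centsP => x _ y _; apply: addrC.
have [b defG ob] := abelian_structure abG.
have := abelian_type_dvdn_sorted [set: G]; have := abelian_type_gt1 [set: G].
rewrite -{}ob => ob1 obs.
have cG := bigdprod_card defG.
move: (exponent_gt0 [set: G]).
have : forall x : G, (#[x]%g <= exponent [set: G])%N.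
  by move=> x; rewrite dvdn_leq ?exponent_gt0 // dvdn_exponent ?inE.
have cG0 : (0 < #|G|)%N by apply/card_gt0P; exists 0.
move: kexp => /[swap]; move: (exponent _) => e expx kexp e0.
rewrite cardsT in cG.
case: b => [|x b] in ob1 obs defG cG *.
  by rewrite big_nil in cG; rewrite -cG in kexp; nia.
case: b => [|y b] in ob1 obs defG cG *.
  have := expx x; move: kexp; rewrite big_seq1 in cG; rewrite -cG -orderE.
  have := order_gt0 x; nia.
move: ob1 obs => /= /and3P[x1 y1 ob1] /andP[yx obs].
have [R defR] : exists R : {group G}, (\big[dprod/1]_(z <- b) <[z]>)%g = R.
  move: defG; rewrite !big_cons => defG.
  have [[_ S _ defS] _ _ _] := dprodP defG; rewrite defS in defG.
  by have [[_ R _ defR] _ _ _] := dprodP defS; exists R.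
have cR := bigdprod_card defR.
have kq : (k <= #[y]%g * #|R|)%N.
  rewrite -(leq_pmul2l (order_gt0 x)) -cR !orderE.
  by move: kexp; rewrite -cG !big_cons; apply: leq_trans; rewrite mulnC leq_mul2l -orderE expx orbT.
rewrite 2!big_cons defR in defG.
have [ky|yk] := leqP k #[y]%g.
  have [C cC pC] := packs_Cd2 defG (order_gt0 y) yx (dvdnn _).
  rewrite cardsT in cC.
  apply: davenport_le_of_packs (pC #|C| (cardG_gt0 C)) cC _.
  exact: bound_rank2 ky (cardG_gt0 C).
case: b => [|z b] in ob1 obs defR cR {cG} *.
  by rewrite big_nil in cR; rewrite -cR in kq; lia.
move: ob1 obs => /= /andP[z1 ob1] /andP[zy obs].
have [S defS] : exists S : {group G}, (\big[dprod/1]_(w <- b) <[w]>)%g = S.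
  move: defR; rewrite !big_cons => defR.
  by have [[_ S _ defS] _ _ _] := dprodP defR; exists S.
have cS := bigdprod_card defS.
rewrite big_cons defS in defR.
have [Y defY] : exists Y : {group G}, (<[y]> \x R)%g = Y.
  by have [[_ Y _ ->] _ _ _] := dprodP defG; exists Y.
rewrite defY in defG.
have cut3 p t (S' : {group G}) : prime p -> (p %| #[z]%g)%N -> pcut p t S S' ->
  exists2 B : {group G}, (<[x ^+ p]> \x (<[y ^+ p]> \x (<[z ^+ p]> \x S')))%g = B
    & pcut p t.+3 [set: G] B.
  move=> pp pz cS'; have p0 := prime_gt0 pp; have py := dvdn_trans pz zy.
  have [R' defR' cutR] := pcut_cycle p0 defR pz cS'.
  have [Y' defY' cutY] := pcut_cycle p0 defY py cutR.
  have [B defB cutB] := pcut_cycle p0 defG (dvdn_trans py yx) cutY.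
  by exists B; rewrite ?defR' ?defY'.
have cutS p : pcut p 0 S S := pcut_refl p S.
have [z2|z2] := boolP (2 %| #[z]%g)%N.
  have [y2|y2] := leqP #[y]%g 2.
    have k3 : (2 < k)%N by apply: leq_ltn_trans yk.
    have ez : #[z]%g = 2%N.
      by apply/eqP; rewrite eqn_leq z1 andbT (leq_trans _ y2) // dvdn_leq.
    case: b => [|w b] in ob1 obs defS cR cS *.
      have k4 : (k <= 4)%N.
        have cR4 : #|R| = 2%N by rewrite -cR big_seq1 -orderE ez.
        by apply: leq_trans kq _; rewrite cR4; exact: leq_mul y2 (leqnn 2).
      have [B _ cutB] := cut3 2 0 S isT z2 (cutS 2).
      have [_ cB _] := cutB; rewrite cardsT in cB.
      have [B1|B1] := leqP #|B| 1.
        (* G = C_2^3: the generic bound 2 j + 3 is one too large when k = 3. *)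
        have cB1 : #|B| = 1%N by apply/eqP; rewrite eqn_leq B1 cardG_gt0.
        apply: (@davenport_le_of_packs _ _ B 4 _ cB); rewrite cB1.
          exact: packs_2rank3_one.
        by apply: bound_2rank3_one; rewrite k3.
      apply: davenport_le_of_packs (packs_2rank3 cutB (cardG_gt0 B)) cB _.
      by apply: bound_2rank3; rewrite ?k3.
    move: ob1 obs => /= /andP[w1 ob1] /andP[wz obs].
    have [T defT] : exists T : {group G}, (\big[dprod/1]_(v <- b) <[v]>)%g = T.
      move: defS; rewrite big_cons => defS.
      by have [[_ T _ defT] _ _ _] := dprodP defS; exists T.
    rewrite big_cons defT in defS.
    have w2 : (2 %| #[w]%g)%N.
      suff -> : #[w]%g = 2%N by [].
      by apply/eqP; rewrite eqn_leq w1 andbT -ez dvdn_leq.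
    have [S' _ cutS'] := pcut_cycle (isT : 0 < 2)%N defS w2 (pcut_refl 2 T).
    have [B _ cutB] := cut3 2 _ _ isT z2 cutS'.
    have [_ cB _] := cutB; rewrite cardsT in cB.
    have B0 := cardG_gt0 B; have [B4|B4] := leqP #|B| 4.
      apply: davenport_le_of_packs (packs_2rank4_small cutB B0) cB _.
      by apply: bound_2rank4_small; rewrite ?k3 ?B0.
    apply: davenport_le_of_packs (packs_2rank4_large cutB (ltnW B4)) cB _.
    by apply: bound_2rank4_large (ltnW B4); rewrite k3.
  have [B defB cutB] := cut3 2 0 S isT z2 (cutS 2).
  (* Here #[y] = 2 d; below C_2^3 there remains a section C_d^2 generated by
     the squares of x and y. *)
  have [d yd] := dvdnP (dvdn_trans z2 zy).
  have [R' defR'] : exists R' : {group G}, (<[z ^+ 2]> \x S)%g = R'.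
    have [[_ Y' _ defY'] _ _ _] := dprodP defB; rewrite defY' in defB.
    by have [[_ R' _ defR'] _ _ _] := dprodP defY'; exists R'.
  rewrite defR' in defB.
  have d1 : (1 < d)%N by move: y2; rewrite yd; lia.
  have [|||C cC pC] := packs_Cd2 (d := d) defB; first exact: ltnW.
  - by rewrite orderXdiv ?(dvdn_trans z2 (dvdn_trans zy yx)) // dvdn_divRL -?yd // (dvdn_trans z2 (dvdn_trans zy yx)).
  - by rewrite orderXdiv ?(dvdn_trans z2 zy) // yd mulnK.
  have [_ cB _] := cutB; rewrite cardsT in cB.
  have C0 := cardG_gt0 C.
  have j0 : (0 < d * #|C| + d - 1)%N by nia.
  apply: davenport_le_of_packs (packs_comp (packs_2rank3 cutB j0) (pC _ C0)) _ _.
    by rewrite cB cC mulnA.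
  by apply: bound_2rank3_rank2 => //; rewrite mulnC -yd yk.
have zy' := dvdn_leq (order_gt0 y) zy.
(* The order of z is odd, larger than 1 and at most #[y] <= 6. *)
have z35 : #[z]%g = 3%N \/ #[z]%g = 5%N by lia.
case: z35 => ez; rewrite ez in z1 zy zy' cut3.
  have k4 := leq_ltn_trans zy' yk.
  have [B _ cutB] := cut3 3 0 S isT isT (cutS 3).
  have [_ cB _] := cutB; rewrite cardsT in cB.
  have B0 := cardG_gt0 B; have [B7|B7] := leqP #|B| 7.
    apply: davenport_le_of_packs (packs_3rank3_small cutB B0) cB _.
    by apply: bound_3rank3_small; rewrite ?k4 ?B0.
  apply: davenport_le_of_packs (packs_3rank3_large cutB (ltnW B7)) cB _.
  by apply: bound_3rank3_large (ltnW B7); rewrite k4.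
have [B _ cutB] := cut3 5 0 S isT isT (cutS 5).
have [_ cB _] := cutB; rewrite cardsT in cB.
apply: davenport_le_of_packs (@packs_rank3_mul 5 #|B| _ _ isT cutB) cB _.
by apply: bound_5rank3; rewrite k7 (leq_ltn_trans zy' yk).
Qed.

End Chains.

Theorem theorem1 (G : finZmodType) (n m : nat)
    (hn : n = #|G|) (hm : m = exponent [set: G])
    (k : nat) (hk0 : (0 < k)%N) (hk7 : (k <= 7)%N)
    (hnm : k%:R <= n%:R / m%:R :> rat) :
  (davenport G)%:R <= n%:R / k%:R + (k%:R - 1) :> rat.
Proof.
have m0 : (0 < m)%N by rewrite hm exponent_gt0.
have km : (k * m <= n)%N.
  by move: hnm; rewrite ler_pdivlMr ?ltr0n // -natrM ler_nat.
have := @davenport_bound G k; rewrite -hn -hm hk0 hk7 => /(_ isT km) bound.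
have k1 : k%:R - 1 = k.-1%:R :> rat by rewrite -{1}(prednK hk0) -natr1 addrK.
rewrite k1 -(ler_pM2l (_ : 0 < k%:R)) ?ltr0n // mulrDr mulrCA divff ?mulr1.
  by rewrite -!natrM -natrD ler_nat.
by rewrite pnatr_eq0 -lt0n.
Qed.
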